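(* Let $Q_0,Q_{-1}\in\mathbb R^n$ and let $(Q_k)$ be generated by the heavy-ball Q-value iteration $$Q_{k+1}=Q_k+\alpha(F(Q_k)-Q_k)+\eta(Q_k-Q_{k-1}),\qquad k\ge0.$$ For every stochastic policy $\mu$ put $$A_\mu^{\rm HB}:=\begin{bmatrix}(1-\alpha+\eta)I+\alpha\gamma P\Pi^\mu&-\eta I\\ I&0\end{bmatrix},\qquad \mathcal A^{\rm HB}:=\{A_\pi^{\rm HB}:\pi\in\Theta\}.$$ Then for every $k\ge0$ there is a stochastic policy $\mu_k$ with $V_{Q_k}-V_{Q^\star}=\Pi^{\mu_k}(Q_k-Q^\star)$, and with such $\mu_k$ the error satisfies $$\begin{bmatrix}Q_{k+1}-Q^\star\\Q_k-Q^\star\end{bmatrix}=A_{\mu_k}^{\rm HB}\begin{bmatrix}Q_k-Q^\star\\Q_{k-1}-Q^\star\end{bmatrix}.$$ Moreover, for every stochastic selector $\mu_k$, $A_{\mu_k}^{\rm HB}\in\operatorname{co}(\mathcal A^{\rm HB})$.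
   Context: Finite discounted MDP: state set $\mathcal S=\{1,\dots,|\mathcal S|\}$, action set $\mathcal A=\{1,\dots,|\mathcal A|\}$, transition probabilities $P(s'\mid s,a)$, real rewards $r(s,a,s')$, expected reward $R(s,a)=\sum_{s'}P(s'\mid s,a)r(s,a,s')$, discount factor $\gamma\in(0,1)$. Put $n=|\mathcal S||\mathcal A|$. Functions on state-action pairs are vectors in $\mathbb R^n$ (ordering $(1,1),(2,1),\dots,(|\mathcal S|,1),(1,2),\dots$). $P\in\mathbb R^{n\times|\mathcal S|}$ is the matrix with $((s,a),s')$ entry $P(s'\mid s,a)$, and $R\in\mathbb R^n$ is the vector of expected rewards. A stochastic policy $\mu$ assigns to each state $s$ a probability vector $\mu(\cdot\mid s)$ on $\mathcal A$; $\Pi^\mu\in\mathbb R^{|\mathcal S|\times n}$ is the matrix with $(\Pi^\mu Q)(s)=\sum_a\mu(a\mid s)Q(s,a)$. $\Theta$ is the (finite) set of deterministic policies $\pi:\mathcal S\to\mathcal A$, viewed as stochastic policies by one-hot encoding. $V_Q(s)=\max_aQ(s,a)$, $F(Q)=R+\gamma PV_Q$ is the Bellman optimality operator, and $Q^\star$ is its unique fixed point. $0<\alpha\le1$ is the step-size and $\eta\ge0$ the momentum parameter. $\operatorname{co}$ denotes the convex hull of a finite set of matrices. *)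

(* Defs.v *)
From HB Require Import structures.
From mathcomp Require Import all_boot all_order all_algebra.
From mathcomp Require Import classical_sets reals.

Set Implicit Arguments.
Unset Strict Implicit.
Unset Printing Implicit Defensive.
Import Order.TTheory GRing.Theory Num.Theory.
Local Open Scope ring_scope.
Local Open Scope classical_set_scope.

(* There are nS.+1 states and nA.+1 actions, so both sets are nonempty. *)
Record mdp (R : realType) (nS nA : nat) := Mdp {
  trans : 'I_nS.+1 -> 'I_nA.+1 -> 'I_nS.+1 -> R;
  reward : 'I_nS.+1 -> 'I_nA.+1 -> 'I_nS.+1 -> R;
  discount : R;
  trans_ge0 : forall s a s', 0 <= trans s a s';
  trans_sum1 : forall s a, \sum_s' trans s a s' = 1;
  discount_bounds : 0 < discount < 1
}.

(* State-action pairs are indexed by 'I_(nA.+1 * nS.+1). [mxvec_index a s] has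
   value a * nS.+1 + s, so the pairs (s, a) are listed in the order
   (0,0), (1,0), ..., (nS,0), (0,1), ...; accordingly [mxvec] is applied to
   matrices whose rows are actions and whose columns are states. *)
Definition sa_index {nS nA : nat} (s : 'I_nS.+1) (a : 'I_nA.+1) :
  'I_(nA.+1 * nS.+1) := mxvec_index a s.

Definition Qvec (R : realType) (nS nA : nat) := 'cV[R]_(nA.+1 * nS.+1).

Section MDP.
Context {R : realType} {nS nA : nat}.
Implicit Types (M : mdp R nS nA) (Q : Qvec R nS nA).
Implicit Types (mu : 'I_nS.+1 -> 'I_nA.+1 -> R).

Definition trans_mx M : 'M[R]_(nA.+1 * nS.+1, nS.+1) :=
  \matrix_(i, s') mxvec (\matrix_(a, s) trans M s a s') 0 i.

Definition exp_reward M s a : R :=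
  \sum_s' trans M s a s' * reward M s a s'.

Definition reward_vec M : Qvec R nS nA :=
  \col_i mxvec (\matrix_(a, s) exp_reward M s a) 0 i.

(* [mu s a] is the probability mu(a | s). *)
Definition stochastic_policy mu : Prop :=
  forall s, (forall a, 0 <= mu s a) /\ \sum_a mu s a = 1.

Definition one_hot (pi : {ffun 'I_nS.+1 -> 'I_nA.+1}) :
  'I_nS.+1 -> 'I_nA.+1 -> R := fun s a => (pi s == a)%:R.

(* The entry in row s and column (s', a) is mu(a | s) if s' = s, and 0
   otherwise, so that (Pi^mu Q)(s) = sum_a mu(a | s) Q(s, a). *)
Definition policy_mx mu : 'M[R]_(nS.+1, nA.+1 * nS.+1) :=
  \matrix_(s, i) mxvec (\matrix_(a, s') (mu s a *+ (s' == s))) 0 i.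

(* The value at action [ord0] only serves as the (harmless) initial value of
   the iterated maximum. *)
Definition Vmax Q : 'cV[R]_nS.+1 :=
  \col_s \big[Num.max/Q (sa_index s ord0) 0]_(a < nA.+1) Q (sa_index s a) 0.

Definition bellman M Q : Qvec R nS nA :=
  reward_vec M + discount M *: (trans_mx M *m Vmax Q).

Definition HB_mx M (alpha eta : R) mu :
  'M[R]_(nA.+1 * nS.+1 + nA.+1 * nS.+1) :=
  block_mx ((1 - alpha + eta)%:M
              + (alpha * discount M) *: (trans_mx M *m policy_mx mu))
           (- eta%:M)
           1%:M
           0.

Definition HB_family M (alpha eta : R) :
  set 'M[R]_(nA.+1 * nS.+1 + nA.+1 * nS.+1) :=
  [set HB_mx M alpha eta (one_hot pi) | pi in [set: {ffun 'I_nS.+1 -> 'I_nA.+1}]].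

(* The sequence starts at index -1; its values below -1 are irrelevant. *)
Definition heavy_ball_QVI M (alpha eta : R) (Q : int -> Qvec R nS nA) : Prop :=
  forall k : nat,
    Q (k%:Z + 1) = Q k%:Z + alpha *: (bellman M (Q k%:Z) - Q k%:Z)
                   + eta *: (Q k%:Z - Q (k%:Z - 1)).

End MDP.

Definition convex_hull {R : realType} {E : lmodType R} (X : set E) : set E :=
  [set x | exists (m : nat) (w : 'I_m -> R) (y : 'I_m -> E),
     [/\ forall i, 0 <= w i, \sum_i w i = 1, forall i, X (y i)
       & x = \sum_i w i *: y i]].

(* Main.v *)
Require Import Defs.
From HB Require Import structures.
From mathcomp Require Import all_boot all_order all_algebra.
From mathcomp Require Import classical_sets reals.
From mathcomp Require Import ring lra.

Import Order.TTheory GRing.Theory Num.Theory.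
Local Open Scope ring_scope.
Local Open Scope classical_set_scope.

(** The update is affine in [Vmax (Q k)], so both assertions about the error
    reduce to facts about the averaging matrices [policy_mx mu].

    Existence of the selector is a statement about one state at a time. Let [a]
    and [b] be greedy actions at [s] for [Q] and [Q'], and let [D = Q - Q'].
    Optimality of [b] for [Q'] gives [V_Q(s) - V_Q'(s) <= D(s, a)], and
    optimality of [a] for [Q] gives [D(s, b) <= V_Q(s) - V_Q'(s)]. The
    difference of the maxima thus lies between two values of [D(s, .)], and
    randomizing between [a] and [b] attains it ([Vmax_sub_policy]). Replacing
    [Vmax (Q k) - Vmax Qstar] by [policy_mx mu *m (Q k - Qstar)] in the
    recursion, minus the fixed-point equation, gives the first block row of the
    error system; the second block row is the identity [Q k = Q k].

    For the convex hull, a stochastic policy is a mixture of deterministic ones: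
    draw the action of every state independently, so that [pi] has weight
    [prod_s mu(pi(s) | s)]. These weights sum to 1, and their marginal at [s] is
    [mu(. | s)] ([policy_weight_marginal]). As [HB_mx] is affine in the policy
    ([HB_mx_mix]), the same weights express [HB_mx mu] as a convex combination
    of the matrices [HB_mx pi]. *)

Section Vmax.
Context {R : realType} {nS nA : nat}.
Implicit Types (Q : Qvec R nS nA) (mu : 'I_nS.+1 -> 'I_nA.+1 -> R).

Lemma Vmax_ge Q s a : Q (sa_index s a) 0 <= Vmax Q s 0.
Proof. by rewrite mxE (le_bigmax _ (fun c => Q (sa_index s c) 0) a). Qed.

Lemma Vmax_attained Q s : exists a, Vmax Q s 0 = Q (sa_index s a) 0.
Proof.
rewrite mxE; elim/big_ind: _ => [|x y [a ->] [b ->]|a _]; first by exists ord0.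
  by rewrite maxEle; case: ifP => _; [exists b | exists a].
by exists a.
Qed.

Lemma policy_mxM mu Q s :
  (policy_mx mu *m Q) s 0 = \sum_a mu s a * Q (sa_index s a) 0.
Proof.
rewrite mxE (reindex _ (curry_mxvec_bij nA.+1 nS.+1)) /=.
transitivity (\sum_a \sum_s' (mu s a *+ (s' == s)) * Q (sa_index s' a) 0).
  by rewrite pair_bigA; apply: eq_bigr => -[a s'] _ /=; rewrite mxE mxvecE mxE.
apply: eq_bigr => a _; rewrite (bigD1 s) //= eqxx mulr1n big1 ?addr0 // => s'.
by move=> /negPf ->; rewrite mulr0n mul0r.
Qed.

(** The witness [p] charges only [a] and [b], with the barycentric weights of
    [v] in the segment from [f b] to [f a]; when that segment is a single point
    these weights are undefined, and all the mass goes to [a]. *)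
Lemma mix_between (f : 'I_nA.+1 -> R) a b v :
  f b <= v <= f a ->
  exists p : 'I_nA.+1 -> R,
    [/\ forall c, 0 <= p c, \sum_c p c = 1 & v = \sum_c p c * f c].
Proof.
move=> /andP[hb ha].
have [t [t0 t1 ->]] : exists t,
    [/\ 0 <= t, t <= 1 & v = t * f a + (1 - t) * f b].
  case: (ltP (f b) (f a)) => [lt_ba|le_ab].
    have d_gt0 : 0 < f a - f b by rewrite subr_gt0.
    exists ((v - f b) / (f a - f b)); split.
    - by apply: divr_ge0; [rewrite subr_ge0 | apply: ltW].
    - by rewrite ler_pdivrMr // mul1r lerD2r.
    - by field; rewrite gt_eqF.
  by exists 1; split; lra.
have sum_pick (g : 'I_nA.+1 -> R) c : \sum_d (d == c)%:R * g d = g c.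
  rewrite (bigD1 c) //= eqxx mul1r big1 ?addr0 // => d /negPf ->.
  by rewrite mul0r.
have sum_mix g : \sum_c (t * (c == a)%:R + (1 - t) * (c == b)%:R) * g c
    = t * g a + (1 - t) * g b.
  rewrite -(sum_pick g a) -(sum_pick g b) !mulr_sumr -big_split /=.
  by apply: eq_bigr => c _; ring.
exists (fun c => t * (c == a)%:R + (1 - t) * (c == b)%:R); split => //.
- by move=> c; rewrite addr_ge0 // mulr_ge0 // subr_ge0.
- have := sum_mix (fun=> 1); rewrite !mulr1 (addrC t) subrK => sum1.
  by rewrite -[RHS]sum1; apply: eq_bigr => c _; rewrite mulr1.
Qed.

(** At each state the difference of the maxima is bracketed by the values of
    [Q - Q'] at a greedy action for [Q] and at one for [Q']. *)
Lemma Vmax_sub_policy Q Q' : exists mu,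
  stochastic_policy mu /\ Vmax Q - Vmax Q' = policy_mx mu *m (Q - Q').
Proof.
have selector s : exists p : 'I_nA.+1 -> R,
    [/\ forall c, 0 <= p c, \sum_c p c = 1
      & Vmax Q s 0 - Vmax Q' s 0 = \sum_c p c * (Q - Q') (sa_index s c) 0].
  have [a Va] := Vmax_attained Q s; have [b Vb] := Vmax_attained Q' s.
  apply: (@mix_between (fun c => (Q - Q') (sa_index s c) 0) a b).
  have := Vmax_ge Q s b; have := Vmax_ge Q' s a.
  by rewrite !mxE -/(Vmax Q) -/(Vmax Q') in Va Vb *; rewrite Va Vb; lra.
have [mu hmu] := fin_all_exists selector.
exists mu; split; first by move=> s; have [] := hmu s.
apply/colP => s; rewrite policy_mxM; have [_ _ <-] := hmu s.
by rewrite !mxE.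
Qed.

End Vmax.

Section Error.
Context {R : realType} {nS nA : nat}.
Implicit Types (M : mdp R nS nA) (X : Qvec R nS nA).

Lemma HB_mx_error M alpha eta mu Qstar X Xprev :
  bellman M Qstar = Qstar ->
  Vmax X - Vmax Qstar = policy_mx mu *m (X - Qstar) ->
  col_mx (X + alpha *: (bellman M X - X) + eta *: (X - Xprev) - Qstar)
         (X - Qstar)
  = HB_mx M alpha eta mu *m col_mx (X - Qstar) (Xprev - Qstar).
Proof.
move=> fixQ dV; rewrite mul_block_col mul1mx mul0mx addr0; congr col_mx.
rewrite mulmxDl mul_scalar_mx -scalemxAl -mulmxA -dV mulNmx mul_scalar_mx.
have -> : bellman M X
    = Qstar + discount M *: (trans_mx M *m (Vmax X - Vmax Qstar)).
  by rewrite -[X in X + _]fixQ /bellman mulmxBr scalerBr [RHS]addrA addrAC addrK.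
by apply/colP => i; rewrite !mxE; ring.
Qed.

End Error.

Section Mixture.
Context {R : realType} {nS nA : nat}.
Implicit Types (M : mdp R nS nA) (mu : 'I_nS.+1 -> 'I_nA.+1 -> R).

Lemma policy_mx_mix (I : finType) (w : I -> R)
    (nu : I -> 'I_nS.+1 -> 'I_nA.+1 -> R) :
  policy_mx (fun s a => \sum_i w i * nu i s a)
  = \sum_i w i *: policy_mx (nu i).
Proof.
apply/matrixP => s k; case/mxvec_indexP: k => a s'.
rewrite summxE mxE mxvecE mxE -sumrMnl.
by apply: eq_bigr => i _; rewrite !mxE mxvecE mxE mulrnAr.
Qed.

(** Only the upper left block depends on the policy, and it does so linearly up
    to a constant term; that the weights sum to 1 takes care of the constant
    blocks. *)
Lemma HB_mx_mix M alpha eta (I : finType) (w : I -> R)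
    (nu : I -> 'I_nS.+1 -> 'I_nA.+1 -> R) :
  \sum_i w i = 1 ->
  HB_mx M alpha eta (fun s a => \sum_i w i * nu i s a)
  = \sum_i w i *: HB_mx M alpha eta (nu i).
Proof.
move=> w1; pose n := (nA.+1 * nS.+1)%N.
pose C : 'M[R]_(n + n) :=
  block_mx (1 - alpha + eta)%:M (- eta%:M) 1%:M 0.
(* Writing the embedding of the upper left block as a two-sided product makes
   its linearity that of matrix multiplication. *)
pose L : 'M[R]_(n + n, nS.+1) :=
  (alpha * discount M) *: (col_mx 1%:M 0 *m trans_mx M).
have HBE mu : HB_mx M alpha eta mu = C + L *m policy_mx mu *m row_mx 1%:M 0.
  rewrite /L mul_col_mx mul1mx mul0mx scale_col_mx scaler0 mul_col_mx mul0mx.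
  rewrite mul_col_row mulmx1 !mulmx0 mul0mx.
  by rewrite add_block_mx !addr0 /HB_mx scalemxAl.
have CE : C = \sum_i w i *: C by rewrite -scaler_suml w1 scale1r.
rewrite HBE policy_mx_mix mulmx_sumr mulmx_suml CE -big_split /=.
by apply: eq_bigr => i _; rewrite [in RHS]HBE scalerDr -scalemxAr -scalemxAl.
Qed.

(** The probability of [pi] when the actions of the states are drawn
    independently according to [mu]. *)
Definition policy_weight mu (pi : {ffun 'I_nS.+1 -> 'I_nA.+1}) : R :=
  \prod_s mu s (pi s).

Lemma policy_weight_ge0 mu pi : stochastic_policy mu -> 0 <= policy_weight mu pi.
Proof. by move=> hmu; apply: prodr_ge0 => s _; have [] := hmu s. Qed.

Lemma policy_weight_sum1 mu :
  stochastic_policy mu -> \sum_pi policy_weight mu pi = 1.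
Proof.
move=> hmu; rewrite -(bigA_distr_bigA (fun s a => mu s a)) big1 // => s _.
by have [] := hmu s.
Qed.

(** Absorbing the indicator of [pi s = a] into the factor at [s] leaves a sum of
    products, which factors over the states: every state other than [s]
    contributes its total mass 1. *)
Lemma policy_weight_marginal mu s a : stochastic_policy mu ->
  \sum_pi policy_weight mu pi * one_hot pi s a = mu s a.
Proof.
move=> hmu.
pose g t c : R := mu t c * (if t == s then (c == a)%:R else 1).
transitivity (\sum_(pi : {ffun 'I_nS.+1 -> 'I_nA.+1}) \prod_t g t (pi t)).
  apply: eq_bigr => pi _; rewrite big_split /=; congr (_ * _).
  by rewrite -big_mkcond big_pred1_eq.
rewrite -bigA_distr_bigA (bigD1 s) //= [X in _ * X]big1 ?mulr1 => [|t /negPf ts].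
  rewrite (bigD1 a) //= /g !eqxx mulr1 big1 ?addr0 // => c /negPf ->.
  by rewrite mulr0.
by have [_ <-] := hmu t; apply: eq_bigr => c _; rewrite /g ts mulr1.
Qed.

End Mixture.

(** Enumerating [I] turns a mixture over [I], here the set of deterministic
    policies, into one indexed by ['I_m], as [convex_hull] asks. *)
Lemma convex_hull_fin (R : realType) (E : lmodType R) (X : set E)
    (I : finType) (w : I -> R) (y : I -> E) :
  (forall i, 0 <= w i) -> \sum_i w i = 1 -> (forall i, X (y i)) ->
  convex_hull X (\sum_i w i *: y i).
Proof.
move=> w0 w1 Xy; exists #|I|, (w \o enum_val), (y \o enum_val).
have enumE (V : nmodType) (F : I -> V) :
    \sum_i F i = \sum_(k < #|I|) F (enum_val k).
  by rewrite (reindex _ (onW_bij _ (@enum_val_bij I))).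
split=> [k||k|] /=; [exact: w0 | | exact: Xy | exact: enumE].
by rewrite -enumE.
Qed.

Theorem lemma5p2 (R : realType) (nS nA : nat) (M : mdp R nS nA)
    (alpha eta : R) (halpha : 0 < alpha <= 1) (heta : 0 <= eta)
    (Qstar : Qvec R nS nA) (hQstar : bellman M Qstar = Qstar)
    (Q : int -> Qvec R nS nA) (hQ : heavy_ball_QVI M alpha eta Q) :
  (forall k : nat,
     (exists mu : 'I_nS.+1 -> 'I_nA.+1 -> R,
        stochastic_policy mu /\
        Vmax (Q k%:Z) - Vmax Qstar = policy_mx mu *m (Q k%:Z - Qstar)) /\
     (forall mu : 'I_nS.+1 -> 'I_nA.+1 -> R,
        stochastic_policy mu ->
        Vmax (Q k%:Z) - Vmax Qstar = policy_mx mu *m (Q k%:Z - Qstar) ->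
        col_mx (Q (k%:Z + 1) - Qstar) (Q k%:Z - Qstar) =
        HB_mx M alpha eta mu *m col_mx (Q k%:Z - Qstar) (Q (k%:Z - 1) - Qstar)))
  /\
  (forall mu : 'I_nS.+1 -> 'I_nA.+1 -> R,
     stochastic_policy mu ->
     convex_hull (HB_family M alpha eta) (HB_mx M alpha eta mu)).
Proof.
split=> [k|mu hmu].
  split; first exact: Vmax_sub_policy.
  by move=> mu _ dV; rewrite hQ; apply: HB_mx_error.
have -> : HB_mx M alpha eta mu
    = \sum_pi policy_weight mu pi *: HB_mx M alpha eta (one_hot pi).
  rewrite -HB_mx_mix ?policy_weight_sum1 //.
  congr (block_mx (_ + _ *: (_ *m _)) _ _ _).
  apply/matrixP => s i; case/mxvec_indexP: i => a s'.
  by rewrite !mxE !mxvecE !mxE policy_weight_marginal.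
apply: convex_hull_fin.
- by move=> pi; apply: policy_weight_ge0.
- exact: policy_weight_sum1.
- by move=> pi; exists pi.
Qed.
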